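(* Let $K_2$ be the $2$-dimensional complex Lie algebra with basis $z_1,z_2$ and bracket $[z_1,z_2]=z_1$. Up to inner automorphism, there are five families of subalgebras of $\mathfrak{so}(4,\mathbb{C})$ that are isomorphic to $K_2$, two of them infinite: $$K_2^1=\langle x_1+x_2,\ h_1+h_2\rangle,\qquad K_2^{2,a}=\langle x_1,\ h_1+a h_2\rangle,\qquad K_2^3=\langle x_1,\ h_1+x_2\rangle,$$ $$K_2^{4,a}=\langle x_2,\ h_2+a h_1\rangle,\qquad K_2^5=\langle x_2,\ h_2+x_1\rangle,$$ for $a\in\mathbb{C}$, and such that, for $i=2,4$ and $a,b\in\mathbb{C}$, $K_2^{i,a}\sim K_2^{i,b}$ if and only if $a=\pm b$. That is: each listed subalgebra is isomorphic to $K_2$, every subalgebra of $\mathfrak{so}(4,\mathbb{C})$ isomorphic to $K_2$ is equivalent to one of those listed, members of different families are never equivalent, and equivalence inside the families $K_2^{2,a}$ and $K_2^{4,a}$ is as stated.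
   Context: $\mathfrak{so}(4,\mathbb{C})\cong\mathfrak{sl}(2,\mathbb{C})\oplus\mathfrak{sl}(2,\mathbb{C})$ is realized as the Lie algebra of $4\times4$ complex block diagonal matrices with two traceless $2\times 2$ diagonal blocks. With $E_{ij}$ the $4\times 4$ matrix units, its Chevalley basis is $x_1=E_{12}$, $y_1=E_{21}$, $h_1=E_{11}-E_{22}$, $x_2=E_{34}$, $y_2=E_{43}$, $h_2=E_{33}-E_{44}$. The notation $\langle\cdots\rangle$ denotes complex linear span. The inner automorphisms of $\mathfrak{so}(4,\mathbb{C})$ are the maps $X\mapsto AXA^{-1}$ with $A\in SL(2,\mathbb{C})\times SL(2,\mathbb{C})$ (block diagonal $4\times4$ matrices with both $2\times2$ blocks of determinant $1$). Two subalgebras $S,S'$ are equivalent (up to inner automorphism), written $S\sim S'$, if $\psi(S)=S'$ for some inner automorphism $\psi$ of $\mathfrak{so}(4,\mathbb{C})$. *)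

(* Defs.v *)
From mathcomp Require Import all_boot all_order all_algebra.
From mathcomp Require Export complex.
From mathcomp Require Import ring.

Set Implicit Arguments.
Unset Strict Implicit.
Unset Printing Implicit Defensive.

Import GRing.Theory.
Local Open Scope ring_scope.

Section LieBracket.
Variables (F : fieldType) (V : lmodType F).

Definition is_lie_bracket (br : V -> V -> V) : Prop :=
  [/\ forall (c : F) u v w, br (c *: u + v) w = c *: br u w + br v w,
      forall (c : F) u v w, br u (c *: v + w) = c *: br u v + br u w,
      forall u, br u u = 0 &
      forall u v w, br u (br v w) + br v (br w u) + br w (br u v) = 0].

End LieBracket.

Section So4.
Variable F : fieldType.

(* Size 2 + 2 (convertible to 4) makes the two diagonal 2 x 2 blocks          *)
(* accessible to block_mx.                                                    *)
Notation M4 := 'M[F]_(2 + 2).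

Definition so4 : {pred M4} := fun X : M4 =>
  [&& ursubmx X == 0, dlsubmx X == 0,
      \tr (ulsubmx X) == 0 & \tr (drsubmx X) == 0].

Definition bracket (X Y : M4) : M4 := X *m Y - Y *m X.

Definition subalgebra (S : {vspace M4}) : Prop :=
  {subset S <= so4} /\ {in S &, forall X Y, bracket X Y \in S}.

(* The indices of matrix units start at 1.                                    *)
Definition E (i j : nat) : M4 :=
  delta_mx (inord i.-1 : 'I_4) (inord j.-1 : 'I_4).

Definition x1 : M4 := E 1 2.
Definition y1 : M4 := E 2 1.
Definition h1 : M4 := E 1 1 - E 2 2.
Definition x2 : M4 := E 3 4.
Definition y2 : M4 := E 4 3.
Definition h2 : M4 := E 3 3 - E 4 4.

Definition in_SL2xSL2 (A : M4) : Prop :=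
  exists A1 A2 : 'M[F]_2,
    [/\ \det A1 = 1, \det A2 = 1 & A = block_mx A1 0 0 A2].

(* Conjugation is taken on all 4 x 4 matrices; for A in SL2 x SL2 it          *)
(* preserves so4 (conj_so4 below).                                            *)
Definition conj_by (A : M4) : 'End(M4) :=
  linfun (mulmxr (invmx A) \o mulmx A).

Definition inner_aut (psi : 'End(M4)) : Prop :=
  exists2 A : M4, in_SL2xSL2 A & psi = conj_by A.

Definition equivalent (S S' : {vspace M4}) : Prop :=
  exists2 psi : 'End(M4), inner_aut psi & (psi @: S)%VS = S'.

(* The abstract Lie algebra K2: row vectors of length 2 with basis z1, z2,    *)
(* and the alternating bilinear bracket determined by [z1, z2] = z1.          *)
Definition z1 : 'rV[F]_2 := delta_mx 0 0.
Definition z2 : 'rV[F]_2 := delta_mx 0 1.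

Definition K2_bracket (u v : 'rV[F]_2) : 'rV[F]_2 :=
  (u 0 0 * v 0 1 - u 0 1 * v 0 0) *: z1.

Definition isomorphic_to_K2 (S : {vspace M4}) : Prop :=
  exists f : 'Hom('rV[F]_2, M4),
    [/\ lker f = 0%VS, limg f = S &
        forall u v, f (K2_bracket u v) = bracket (f u) (f v)].

Inductive K2_index : Type :=
| I1 | I2 of F | I3 | I4 of F | I5.

Definition K2_family (i : K2_index) : nat :=
  match i with I1 => 1 | I2 _ => 2 | I3 => 3 | I4 _ => 4 | I5 => 5 end.

Definition K2_sub (i : K2_index) : {vspace M4} :=
  match i with
  | I1 => span [:: x1 + x2; h1 + h2]
  | I2 a => span [:: x1; h1 + a *: h2]
  | I3 => span [:: x1; h1 + x2]
  | I4 a => span [:: x2; h2 + a *: h1]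
  | I5 => span [:: x2; h2 + x1]
  end.

Lemma bracket_lie : is_lie_bracket bracket.
Proof.
rewrite /bracket; split=> [c u v w|c u v w|u|u v w].
- by rewrite mulmxDl mulmxDr -scalemxAl -scalemxAr scalerBr opprD addrACA.
- by rewrite mulmxDl mulmxDr -scalemxAl -scalemxAr scalerBr opprD addrACA.
- exact: subrr.
- rewrite !mulmxBl !mulmxBr !mulmxA; apply/matrixP=> i j; rewrite !mxE.
  by ring.
Qed.

Lemma K2_bracket_lie : is_lie_bracket K2_bracket.
Proof.
by rewrite /K2_bracket; split=> *; apply/matrixP=> i j; rewrite !mxE /=; ring.
Qed.

Lemma K2_bracket_z : K2_bracket z1 z2 = z1.
Proof. by rewrite /K2_bracket !mxE /= mulr1 mulr0 subr0 scale1r. Qed.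

Lemma K2_basis (u : 'rV[F]_2) : u = u 0 0 *: z1 + u 0 1 *: z2.
Proof.
have e1 : lift ord0 ord0 = 1 :> 'I_2 by apply: val_inj.
by rewrite [LHS]row_sum_delta big_ord_recl big_ord1 e1.
Qed.

Lemma conj_byE A X : conj_by A X = A *m X *m invmx A.
Proof. by rewrite lfunE. Qed.

Lemma so4P X :
  reflect (exists A B : 'M[F]_2,
             [/\ \tr A = 0, \tr B = 0 & X = block_mx A 0 0 B])
          (X \in so4).
Proof.
apply: (iffP and4P) => [[/eqP ur /eqP dl /eqP tA /eqP tB]|[A [B [tA tB ->]]]].
  by exists (ulsubmx X), (drsubmx X); split=> //; rewrite -[LHS]submxK ur dl.
by rewrite block_mxKur block_mxKdl block_mxKul block_mxKdr tA tB !eqxx.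
Qed.

Lemma in_SL2xSL2_unit A : in_SL2xSL2 A -> A \in unitmx.
Proof.
by case=> A1 [A2 [d1 d2 ->]]; rewrite unitmxE det_ublock d1 d2 mulr1 unitr1.
Qed.

Lemma conj_so4 A X : in_SL2xSL2 A -> X \in so4 -> conj_by A X \in so4.
Proof.
move=> SA /so4P[P [Q [tP tQ ->]]]; have uA := in_SL2xSL2_unit SA.
case: SA uA => A1 [A2 [d1 d2 ->]] uA.
have u1 : A1 \in unitmx by rewrite unitmxE d1 unitr1.
have u2 : A2 \in unitmx by rewrite unitmxE d2 unitr1.
have -> : conj_by (block_mx A1 0 0 A2) (block_mx P 0 0 Q) =
    block_mx (A1 *m P *m invmx A1) 0 0 (A2 *m Q *m invmx A2).
  rewrite conj_byE; apply: (canLR (mulmxK uA)).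
  by rewrite !mulmx_block !mulmx0 !mul0mx !addr0 !add0r !mulmxKV.
apply/so4P; eexists; eexists; split; last reflexivity.
- by rewrite mxtrace_mulC mulmxA mulVmx // mul1mx.
- by rewrite mxtrace_mulC mulmxA mulVmx // mul1mx.
Qed.

End So4.

Arguments I1 {F}.
Arguments I2 {F}.
Arguments I3 {F}.
Arguments I4 {F}.
Arguments I5 {F}.

(* Main.v *)
(** The two basis vectors X, Y of a copy of K2 satisfy [X,Y] = X in each of the
    two sl2 blocks. A block where X does not vanish has X nilpotent and can be
    conjugated to (X, -2Y) = (e, h); a block where X vanishes leaves Y arbitrary,
    so -2Y is conjugate to a multiple of h or to e. The blocks are conjugated
    independently, which yields the five families. Conversely an equivalence
    conjugates each block separately, so it preserves determinants and the
    vanishing of blocks: this separates the families, and comparing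
    determinants of h1 + a h2 and its image gives a^2 = b^2 inside a family. *)
Require Import Defs.
From HB Require Import structures.
From mathcomp Require Import all_boot all_order all_algebra.
From mathcomp Require Import reals complex ring.

Set Implicit Arguments.
Unset Strict Implicit.
Unset Printing Implicit Defensive.

Import GRing.Theory Num.Theory.
Local Open Scope ring_scope.

(** * Explicit two by two matrices *)

Section TwoByTwo.
Variable F : comNzRingType.

Definition mx2 (a b c d : F) : 'M[F]_2 :=
  \matrix_(i, j) if i == 0 then (if j == 0 then a else b)
                 else (if j == 0 then c else d).

Lemma mx2_eta (X : 'M[F]_2) : X = mx2 (X 0 0) (X 0 1) (X 1 0) (X 1 1).
Proof.
apply/matrixP=> i j; rewrite mxE.
by case: i => [[|[|i]] Hi] //; case: j => [[|[|j]] Hj] //=;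
   congr (X _ _); apply: val_inj.
Qed.

Lemma mx2_inj a b c d a' b' c' d' :
  mx2 a b c d = mx2 a' b' c' d' -> [/\ a = a', b = b', c = c' & d = d'].
Proof.
move/matrixP=> e; split.
- by have := e 0 0; rewrite !mxE.
- by have := e 0 1; rewrite !mxE.
- by have := e 1 0; rewrite !mxE.
- by have := e 1 1; rewrite !mxE.
Qed.

Lemma mx2D a b c d a' b' c' d' :
  mx2 a b c d + mx2 a' b' c' d' = mx2 (a + a') (b + b') (c + c') (d + d').
Proof. by apply/matrixP=> i j; rewrite !mxE; do 2!case: ifP. Qed.

Lemma mx2N a b c d : - mx2 a b c d = mx2 (- a) (- b) (- c) (- d).
Proof. by apply/matrixP=> i j; rewrite !mxE; do 2!case: ifP. Qed.

Lemma mx2Z k a b c d : k *: mx2 a b c d = mx2 (k * a) (k * b) (k * c) (k * d).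
Proof. by apply/matrixP=> i j; rewrite !mxE; do 2!case: ifP. Qed.

Lemma mx2_0 : 0 = mx2 0 0 0 0.
Proof. by apply/matrixP=> i j; rewrite !mxE; do 2!case: ifP. Qed.

Lemma mx2_1 : 1%:M = mx2 1 0 0 1.
Proof. by rewrite [LHS]mx2_eta !mxE. Qed.

Lemma mx2M a b c d a' b' c' d' :
  mx2 a b c d *m mx2 a' b' c' d' =
  mx2 (a * a' + b * c') (a * b' + b * d') (c * a' + d * c') (c * b' + d * d').
Proof. by rewrite [LHS]mx2_eta !mxE !big_ord_recl !big_ord0 !mxE /= !addr0. Qed.

Lemma det_mx2 a b c d : \det (mx2 a b c d) = a * d - b * c.
Proof.
rewrite (expand_det_row _ 0) !big_ord_recl big_ord0 /cofactor !det_mx11 !mxE /=.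
by rewrite expr0 expr1 addr0 mul1r mulN1r mulrN.
Qed.

Lemma tr_mx2 a b c d : \tr (mx2 a b c d) = a + d.
Proof. by rewrite /mxtrace !big_ord_recl big_ord0 !mxE /= addr0. Qed.

End TwoByTwo.

Definition mx2E := (mx2_0, mx2_1, mx2D, mx2N, mx2Z, mx2M, det_mx2, tr_mx2).

(** * Block diagonal matrices and the Chevalley generators *)

Section Blocks.
Variable F : fieldType.
Implicit Types (U V : 'M[F]_2) (X Y : 'M[F]_(2 + 2)) (S T : {vspace 'M[F]_(2 + 2)}).

Definition sl2_e : 'M[F]_2 := mx2 0 1 0 0.
Definition sl2_h : 'M[F]_2 := mx2 1 0 0 (-1).

Lemma sl2_e_neq0 : sl2_e != 0 :> 'M[F]_2.
Proof. by apply/eqP; rewrite mx2_0 => /mx2_inj[_ /eqP]; rewrite oner_eq0. Qed.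

Lemma det_sl2_e : \det sl2_e = 0.
Proof. by rewrite det_mx2; ring. Qed.

Lemma det_sl2_h : \det sl2_h = -1.
Proof. by rewrite det_mx2; ring. Qed.

Lemma sl2_comb (c d : F) : c *: sl2_e + d *: sl2_h = mx2 d c 0 (- d).
Proof. by rewrite /sl2_e /sl2_h !mx2E; congr mx2; ring. Qed.

Lemma sl2_comb_eq0 (c d : F) : c *: sl2_e + d *: sl2_h = 0 -> c = 0 /\ d = 0.
Proof. by rewrite sl2_comb mx2_0 => /mx2_inj[-> ->]. Qed.

Lemma det_scale_sl2_h (c : F) : \det (c *: sl2_h) = - c ^+ 2.
Proof. by rewrite !mx2E; ring. Qed.

Lemma det_sl2_comb (c d : F) : \det (c *: sl2_e + d *: sl2_h) = - d ^+ 2.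
Proof. by rewrite sl2_comb det_mx2; ring. Qed.

(** A multiple of h is semisimple, so it can only be nilpotent by being zero. This is what tells
    families 3 and 5 from families 2 and 4. *)
Lemma scale_sl2_h_nilpotent (c : F) : \det (c *: sl2_h) = 0 -> c *: sl2_h = 0.
Proof.
by rewrite det_scale_sl2_h => /eqP; rewrite oppr_eq0 expf_eq0 /= => /eqP->;
  rewrite scale0r.
Qed.

Definition diag2 U V : 'M[F]_(2 + 2) := block_mx U 0 0 V.

Lemma ulsubmx_diag2 U V : ulsubmx (diag2 U V) = U.
Proof. exact: block_mxKul. Qed.

Lemma drsubmx_diag2 U V : drsubmx (diag2 U V) = V.
Proof. exact: block_mxKdr. Qed.

Lemma diag2D U V U' V' : diag2 U V + diag2 U' V' = diag2 (U + U') (V + V').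
Proof. by rewrite /diag2 add_block_mx !addr0. Qed.

Lemma diag2N U V : - diag2 U V = diag2 (- U) (- V).
Proof. by rewrite /diag2 opp_block_mx !oppr0. Qed.

Lemma diag2Z k U V : k *: diag2 U V = diag2 (k *: U) (k *: V).
Proof. by rewrite /diag2 scale_block_mx !scaler0. Qed.

Lemma diag2M U V U' V' : diag2 U V *m diag2 U' V' = diag2 (U *m U') (V *m V').
Proof. by rewrite /diag2 mulmx_block !mulmx0 !mul0mx !addr0 !add0r. Qed.

Lemma diag2_0 : diag2 0 0 = 0.
Proof. exact: block_mx0. Qed.

Lemma diag2_inj U V U' V' : diag2 U V = diag2 U' V' -> U = U' /\ V = V'.
Proof. by case/eq_block_mx. Qed.

Definition diag2E := (diag2D, diag2N, diag2Z, diag2M).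

Lemma E_ul (i j : 'I_2) : E F i.+1 j.+1 = diag2 (delta_mx i j) 0.
Proof.
have lt4 (m : 'I_2) : (m < 4)%N by apply: leq_trans (ltn_ord m) _.
apply/matrixP=> k l; rewrite mxE -!val_eqE /= !inordK //.
case: (split_ordP k) => k' ->; case: (split_ordP l) => l' ->;
  rewrite ?block_mxEul ?block_mxEur ?block_mxEdl ?block_mxEdr ?mxE -?val_eqE //=.
- by rewrite [(_ + l')%N == j]gtn_eqF ?andbF // ltn_addr.
- by rewrite [(_ + k')%N == i]gtn_eqF // ltn_addr.
- by rewrite [(_ + k')%N == i]gtn_eqF // ltn_addr.
Qed.

(** The offset 3 is the block size 2 plus the shift caused by [E] counting from 1. *)
Lemma E_dr (i j : 'I_2) : E F i.+3 j.+3 = diag2 0 (delta_mx i j).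
Proof.
have lt4 (m : 'I_2) : (m.+2 < 4)%N by exact: ltn_ord m.
apply/matrixP=> k l; rewrite mxE -!val_eqE /= !inordK //.
case: (split_ordP k) => k' ->; case: (split_ordP l) => l' ->;
  rewrite ?block_mxEul ?block_mxEur ?block_mxEdl ?block_mxEdr ?mxE -?val_eqE //=.
- by rewrite [k' == _ :> nat]ltn_eqF // (leq_trans (ltn_ord k')).
- by rewrite [k' == _ :> nat]ltn_eqF // (leq_trans (ltn_ord k')).
- by rewrite [l' == _ :> nat]ltn_eqF ?andbF // (leq_trans (ltn_ord l')).
Qed.

Lemma x1E : x1 F = diag2 sl2_e 0.
Proof. by rewrite /x1 (E_ul 0 1) [delta_mx _ _]mx2_eta !mxE. Qed.

Lemma x2E : x2 F = diag2 0 sl2_e.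
Proof. by rewrite /x2 (E_dr 0 1) [delta_mx _ _]mx2_eta !mxE. Qed.

Lemma h1E : h1 F = diag2 sl2_h 0.
Proof.
rewrite /h1 (E_ul 0 0) (E_ul 1 1) !diag2E subr0; congr diag2.
by rewrite [LHS]mx2_eta !mxE /= !subr0 sub0r.
Qed.

Lemma h2E : h2 F = diag2 0 sl2_h.
Proof.
rewrite /h2 (E_dr 0 0) (E_dr 1 1) !diag2E subr0; congr diag2.
by rewrite [LHS]mx2_eta !mxE /= !subr0 sub0r.
Qed.

Definition so4E := (x1E, x2E, h1E, h2E).

Lemma diag2_so4 U V : \tr U = 0 -> \tr V = 0 -> diag2 U V \in so4 (F := F).
Proof. by move=> tU tV; apply/so4P; exists U, V. Qed.

Lemma mem_span2 (u w v : 'M[F]_(2 + 2)) :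
  reflect (exists c d, v = c *: u + d *: w) (v \in <<[:: u; w]>>%VS).
Proof.
rewrite span_cons span_seq1; apply: (iffP memv_addP).
  by case=> _ /vlineP[c ->] [_ /vlineP[d ->] ->]; exists c, d.
case=> c [d ->]; exists (c *: u); first exact: memvZ (memv_line _).
by exists (d *: w); first exact: memvZ (memv_line _).
Qed.

(** * Equivalence and blockwise similarity *)

Lemma sl2_inv U : \det U = 1 -> exists2 U', \det U' = 1 & U *m U' = 1%:M.
Proof.
move=> dU; have uU : U \in unitmx by rewrite unitmxE dU unitr1.
by exists (invmx U); rewrite ?mulmxV // det_inv dU invr1.
Qed.

Lemma in_SL2xSL2_inv (A : 'M[F]_(2 + 2)) : in_SL2xSL2 A -> in_SL2xSL2 (invmx A).
Proof.
move=> SA; have uA := in_SL2xSL2_unit SA.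
case: SA uA => A1 [A2 [/sl2_inv[B1 d1 e1] /sl2_inv[B2 d2 e2] ->]] uA.
exists B1, B2; split=> //; rewrite -[RHS](mulKmx uA) -/(diag2 _ _) -/(diag2 B1 _).
by rewrite diag2M e1 e2 /diag2 -scalar_mx_block mulmx1.
Qed.

Lemma equivalent_sym S T : equivalent S T -> equivalent T S.
Proof.
case=> _ [A SA ->] <-; have uA := in_SL2xSL2_unit SA.
exists (conj_by (invmx A)); first by exists (invmx A); first exact: in_SL2xSL2_inv.
rewrite -limg_comp -[RHS]lim1g; congr (_ @: _)%VS.
apply/lfunP=> X; rewrite comp_lfunE id_lfunE !conj_byE invmxK.
by rewrite -!mulmxA mulVmx // mulmx1 mulKmx.
Qed.

(** Intertwining relations let explicit conjugating matrices be checked without computing inverses.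
    They say that conjugation by [P] sends [X'] to [X] and [Y'] to [Y], hence the appeal to
    symmetry. *)
Lemma equivalent_span2 P X Y X' Y' : in_SL2xSL2 P ->
    X *m P = P *m X' -> Y *m P = P *m Y' ->
  equivalent <<[:: X; Y]>>%VS <<[:: X'; Y']>>%VS.
Proof.
move=> SP eX eY; apply: equivalent_sym; have uP := in_SL2xSL2_unit SP.
exists (conj_by P); first by exists P.
by rewrite limg_span /= !conj_byE -eX -eY !mulmxK.
Qed.

(** Conjugacy under GL2 rather than SL2: it already preserves the two invariants used below, the
    determinant and vanishing. *)
Definition similar U V := exists2 P, P \in unitmx & U *m P = P *m V.

Lemma similar_det U V : similar U V -> \det U = \det V.
Proof.
case=> P uP /(congr1 determinant); rewrite !det_mulmx mulrC => /mulrI; apply.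
by rewrite -unitmxE.
Qed.

Lemma similar_eq0 U V : similar U V -> (U == 0) = (V == 0).
Proof.
case=> P uP e; apply/eqP/eqP => [U0|V0].
  by rewrite -[V](mulKmx uP) -e U0 mul0mx mulmx0.
by rewrite -[U](mulmxK uP) e V0 mulmx0 mul0mx.
Qed.

(** With Y = A X A^-1, the relation X A^-1 = A^-1 Y can be read block by block, because A^-1 is
    block diagonal too. *)
Lemma equivalent_similar S T X : equivalent S T -> X \in S ->
  exists2 Y, Y \in T & similar (ulsubmx X) (ulsubmx Y)
                    /\ similar (drsubmx X) (drsubmx Y).
Proof.
case=> _ [A SA ->] <- XS; exists (conj_by A X); first exact: memv_img.
have uA := in_SL2xSL2_unit SA; have := in_SL2xSL2_inv SA.
case=> B1 [B2 [d1 d2 eB]].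
have : X *m invmx A = invmx A *m conj_by A X.
  by rewrite conj_byE !mulmxA mulVmx // mul1mx.
rewrite eB -{1}[X]submxK -{1}[conj_by A X]submxK !mulmx_block.
rewrite !mulmx0 !mul0mx !addr0 !add0r => /eq_block_mx[e1 _ _ e2].
by split; [exists B1|exists B2]; rewrite // unitmxE ?d1 ?d2 unitr1.
Qed.

(** * The listed subalgebras and their isomorphism with K2 *)

Lemma K2_sub_diag2 (i : K2_index F) : K2_sub i =
  match i with
  | I1 => <<[:: diag2 sl2_e sl2_e; diag2 sl2_h sl2_h]>>
  | I2 a => <<[:: diag2 sl2_e 0; diag2 sl2_h (a *: sl2_h)]>>
  | I3 => <<[:: diag2 sl2_e 0; diag2 sl2_h sl2_e]>>
  | I4 a => <<[:: diag2 0 sl2_e; diag2 (a *: sl2_h) sl2_h]>>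
  | I5 => <<[:: diag2 0 sl2_e; diag2 sl2_e sl2_h]>>
  end%VS.
Proof.
by case: i => [|a||a|] /=; rewrite !so4E !diag2E ?scaler0 ?addr0 ?add0r.
Qed.

(** The bracket is bilinear and alternating, so only the determinant of the coefficients
    survives. *)
Lemma bracket_span2 X W (c d c' d' : F) :
  bracket (c *: X + d *: W) (c' *: X + d' *: W) = (c * d' - d * c') *: bracket X W.
Proof.
rewrite /bracket !mulmxDl !mulmxDr -!scalemxAl -!scalemxAr !scalerA.
by apply/matrixP=> i j; rewrite !mxE; ring.
Qed.

Lemma subalgebra_span2 X W (k : F) : X \in so4 (F := F) -> W \in so4 (F := F) ->
  bracket X W = k *: X -> subalgebra <<[:: X; W]>>%VS.
Proof.
move=> /so4P[X1 [X2 [tX1 tX2 defX]]] /so4P[W1 [W2 [tW1 tW2 defW]]] eXW.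
split=> [_ /mem_span2[c [d ->]]|_ _ /mem_span2[c [d ->]] /mem_span2[c' [d' ->]]].
  rewrite defX defW -/(diag2 _ _) -/(diag2 W1 _) !diag2E.
  by apply: diag2_so4; rewrite mxtraceD !mxtraceZ ?tX1 ?tX2 ?tW1 ?tW2 !mulr0 addr0.
apply/mem_span2; exists ((c * d' - d * c') * k), 0; rewrite scale0r addr0 -scalerA -eXW.
by rewrite bracket_span2.
Qed.

Lemma isomorphic_to_K2_span2 X W (k : F) : k != 0 -> X != 0 ->
  bracket X W = k *: X -> isomorphic_to_K2 <<[:: X; W]>>%VS.
Proof.
move=> k0 X0 eXW.
(* Dividing [W] by [k] turns [X, W] = k X into the defining relation [z1, z2] = z1. *)
pose g (u : 'rV[F]_2) := u 0 0 *: X + (u 0 1 / k) *: W.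
have g_lin : linear g.
  by move=> a u v; apply/matrixP=> i j; rewrite !mxE; ring.
pose gL := GRing.isLinear.Build _ _ _ _ g g_lin.
pose gl : {linear 'rV[F]_2 -> 'M[F]_(2 + 2)} := HB.pack g gL.
exists (linfun gl).
have fE u : linfun gl u = g u by rewrite lfunE.
split.
- apply/eqP; rewrite -subv0; apply/subvP=> u; rewrite memv_ker fE memv0 /g.
  move/eqP=> e0; suff [c0 d0] : u 0 0 = 0 /\ u 0 1 = 0.
    by rewrite (K2_basis u) c0 d0 !scale0r addr0.
  (* Bracketing [X] with the vanishing combination leaves [u 0 1 *: X = 0]. *)
  have d0 : u 0 1 = 0.
    have := bracket_span2 X W 1 0 (u 0 0) (u 0 1 / k).
    rewrite e0 eXW mul1r mul0r subr0 scalerA divfK // /bracket mulmx0 mul0mx subrr.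
    by move/esym/eqP; rewrite scaler_eq0 (negPf X0) orbF => /eqP.
  by split=> //; move/eqP: e0; rewrite d0 mul0r scale0r addr0 scaler_eq0
    (negPf X0) orbF => /eqP.
- apply/vspaceP=> v; apply/memv_imgP/mem_span2 => [[u _ ->]|[c [d ->]]].
    by rewrite fE; exists (u 0 0), (u 0 1 / k).
  exists (c *: z1 F + (d * k) *: z2 F); first exact: memvf.
  by rewrite fE /g !mxE /= !mulr1 !mulr0 addr0 add0r mulfK.
- move=> u v; rewrite !fE /g /K2_bracket !mxE /= !(mulr1, mulr0, mul0r, scale0r, addr0).
  by rewrite bracket_span2 eXW scalerA; congr (_ *: _); field.
Qed.

(** Since [e, h] = -2 e, and a zero block satisfies the same relation against anything, every listed
    pair of generators satisfies [X, W] = -2 X. *)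
Lemma K2_sub_subalgebra_iso (i : K2_index F) : 2%:R != 0 :> F ->
  subalgebra (K2_sub i) /\ isomorphic_to_K2 (K2_sub i).
Proof.
move=> two0; have t_e : \tr sl2_e = 0 by rewrite !mx2E addr0.
have t_h : \tr sl2_h = 0 by rewrite !mx2E subrr.
have e0 := sl2_e_neq0.
have iso U V U' V' : (U != 0) || (V != 0) ->
    [/\ \tr U = 0, \tr V = 0, \tr U' = 0 & \tr V' = 0] ->
    U *m U' - U' *m U = -2%:R *: U -> V *m V' - V' *m V = -2%:R *: V ->
  let S := <<[:: diag2 U V; diag2 U' V']>>%VS in
  subalgebra S /\ isomorphic_to_K2 S.
  move=> UV0 [tU tV tU' tV'] eU eV.
  have eUV : bracket (diag2 U V) (diag2 U' V') = -2%:R *: diag2 U V.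
    by rewrite /bracket !diag2E eU eV.
  split; first by apply: subalgebra_span2 eUV; apply: diag2_so4.
  apply: isomorphic_to_K2_span2 eUV; first by rewrite oppr_eq0.
  apply: contraL UV0; rewrite -diag2_0 => /eqP/diag2_inj[-> ->].
  by rewrite eqxx.
rewrite K2_sub_diag2; case: i => [|a||a|]; apply: iso;
  rewrite ?e0 ?orbT //; try (split; rewrite ?mxtraceZ ?t_e ?t_h ?mxtrace0 ?mulr0 //);
  rewrite ?mul0mx ?mulmx0 ?subrr ?scaler0 //; rewrite !mx2E; congr mx2; ring.
Qed.

(** * Inequivalence of different families *)

Lemma equivalent_diag2 S U V U' V' X :
    equivalent S <<[:: diag2 U V; diag2 U' V']>>%VS -> X \in S ->
  exists c d, similar (ulsubmx X) (c *: U + d *: U')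
           /\ similar (drsubmx X) (c *: V + d *: V').
Proof.
move=> eST XS; have [Y + [simU simV]] := equivalent_similar eST XS.
move=> /mem_span2[c [d eY]]; exists c, d.
by move: simU simV; rewrite eY !diag2E ulsubmx_diag2 drsubmx_diag2.
Qed.

Lemma mem_span2l (u w : 'M[F]_(2 + 2)) : u \in <<[:: u; w]>>%VS.
Proof. by rewrite memv_span ?inE ?eqxx. Qed.

Lemma mem_span2r (u w : 'M[F]_(2 + 2)) : w \in <<[:: u; w]>>%VS.
Proof. by rewrite memv_span ?inE ?eqxx ?orbT. Qed.

(** As e and h are independent, an element of the right-hand span is determined by its first block;
    the property passes to [S] by similarity. *)
Lemma equivalent_ulsubmx_eq0 S V V' :
    equivalent S <<[:: diag2 sl2_e V; diag2 sl2_h V']>>%VS ->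
  forall X, X \in S -> ulsubmx X = 0 -> drsubmx X = 0.
Proof.
move=> eST X XS X0; have [c [d []]] := equivalent_diag2 eST XS.
move/similar_eq0; rewrite X0 eqxx => /esym/eqP/sl2_comb_eq0[-> ->].
by move/similar_eq0; rewrite !scale0r addr0 eqxx => /eqP.
Qed.

Lemma equivalent_drsubmx_eq0 S U U' :
    equivalent S <<[:: diag2 U sl2_e; diag2 U' sl2_h]>>%VS ->
  forall X, X \in S -> drsubmx X = 0 -> ulsubmx X = 0.
Proof.
move=> eST X XS X0; have [c [d []]] := equivalent_diag2 eST XS.
move=> simU /similar_eq0; rewrite X0 eqxx => /esym/eqP/sl2_comb_eq0[c0 d0].
by move/similar_eq0: simU; rewrite c0 d0 !scale0r addr0 eqxx => /eqP.
Qed.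

Lemma K2_sub_inequivalent (i j : K2_index F) :
  (K2_family i < K2_family j)%N -> ~ equivalent (K2_sub i) (K2_sub j).
Proof.
move=> ltij /equivalent_sym; rewrite !K2_sub_diag2.
have e0 := sl2_e_neq0.
(* Excludes families 2 and 3 against family 1: the generator with blocks e and 0 violates the
   vanishing property of the second block. *)
have dr0 V' W U' : ~ equivalent <<[:: diag2 sl2_e 0; W]>>%VS
    <<[:: diag2 U' sl2_e; diag2 V' sl2_h]>>%VS.
  move/equivalent_drsubmx_eq0/(_ _ (mem_span2l _ _)).
  by rewrite ulsubmx_diag2 drsubmx_diag2 => /(_ erefl) /eqP; apply/negP.
(* Excludes families 4 and 5 against families 1, 2 and 3. *)
have ul0 V' W U' : ~ equivalent <<[:: diag2 0 sl2_e; W]>>%VS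
    <<[:: diag2 sl2_e U'; diag2 sl2_h V']>>%VS.
  move/equivalent_ulsubmx_eq0/(_ _ (mem_span2l _ _)).
  by rewrite ulsubmx_diag2 drsubmx_diag2 => /(_ erefl) /eqP; apply/negP.
case: i ltij => [|a||a|]; case: j => [|b||b|] //= _;
  do ?[exact: dr0 | exact: ul0] => eST.
(* Family 3 against family 2: the second block e of h1 + x2 would be similar to a multiple of h of
   determinant 0, that is, to 0. *)
- have [c [d [_ sim]]] := equivalent_diag2 eST (mem_span2r _ _).
  move: sim (similar_det sim) (similar_eq0 sim); rewrite drsubmx_diag2.
  rewrite scaler0 add0r scalerA det_sl2_e (negPf e0).
  by move=> _ /esym/scale_sl2_h_nilpotent->; rewrite eqxx.
(* Family 5 against family 4: the same argument in the first block. *)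
- have [c [d [sim _]]] := equivalent_diag2 eST (mem_span2r _ _).
  move: sim (similar_det sim) (similar_eq0 sim); rewrite ulsubmx_diag2.
  rewrite scaler0 add0r scalerA det_sl2_e (negPf e0).
  by move=> _ /esym/scale_sl2_h_nilpotent->; rewrite eqxx.
Qed.

(** * Equivalence inside families 2 and 4 *)

(** Determinants in the first similarity give d^2 = 1, and in the second a^2 = d^2 b^2. *)
Lemma similar_sl2_h_scale (a b c d : F) :
    similar sl2_h (c *: sl2_e + d *: sl2_h) ->
    similar (a *: sl2_h) (c *: 0 + d *: (b *: sl2_h)) ->
  a = b \/ a = - b.
Proof.
move/similar_det; rewrite det_sl2_comb det_sl2_h => /oppr_inj d1.
rewrite scaler0 add0r scalerA => /similar_det; rewrite !det_scale_sl2_h => /oppr_inj.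
by rewrite exprMn -d1 mul1r => /eqP; rewrite eqf_sqr => /orP[]/eqP; [left|right].
Qed.

Lemma scale_sl2_h_conj (a b : F) : a = b \/ a = - b ->
  exists2 P, \det P = 1 & a *: sl2_h *m P = P *m (b *: sl2_h).
Proof.
case=> ->; first by exists 1%:M; rewrite ?det1 // mulmx1 mul1mx.
(* The nontrivial Weyl element of SL2 negates h. *)
by exists (mx2 0 1 (-1) 0); rewrite !mx2E; [ring|congr mx2; ring].
Qed.

Lemma K2_sub_I2_equivalent (a b : F) :
  equivalent (K2_sub (I2 a)) (K2_sub (I2 b)) <-> a = b \/ a = - b.
Proof.
rewrite !K2_sub_diag2; split=> [eST|/scale_sl2_h_conj[P dP eP]].
  have [c [d []]] := equivalent_diag2 eST (mem_span2r _ _).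
  by rewrite ulsubmx_diag2 drsubmx_diag2; apply: similar_sl2_h_scale.
(* Only the block carrying the parameter is moved. *)
apply: (@equivalent_span2 (diag2 1%:M P)).
- by exists 1%:M, P; rewrite det1.
- by rewrite !diag2M mulmx1 mul1mx mulmx0 mul0mx.
- by rewrite !diag2M mulmx1 mul1mx eP.
Qed.

Lemma K2_sub_I4_equivalent (a b : F) :
  equivalent (K2_sub (I4 a)) (K2_sub (I4 b)) <-> a = b \/ a = - b.
Proof.
rewrite !K2_sub_diag2; split=> [eST|/scale_sl2_h_conj[P dP eP]].
  have [c [d []]] := equivalent_diag2 eST (mem_span2r _ _).
  rewrite ulsubmx_diag2 drsubmx_diag2 => /[swap].
  exact: similar_sl2_h_scale.
apply: (@equivalent_span2 (diag2 P 1%:M)).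
- by exists P, 1%:M; rewrite det1.
- by rewrite !diag2M mulmx1 mul1mx mulmx0 mul0mx.
- by rewrite !diag2M mulmx1 mul1mx eP.
Qed.

End Blocks.

(** * Normal forms over an algebraically closed field, and the classification *)

Section Classification.
Variable C : numClosedFieldType.
Local Notation e := (sl2_e C).
Local Notation h := (sl2_h C).
Implicit Types (X Y P : 'M[C]_2) (S : {vspace 'M[C]_(2 + 2)}).

Lemma sqrtC_exists (a : C) : exists t, t ^+ 2 = a.
Proof. by exists (sqrtC a); rewrite sqrtCK. Qed.

(* The columns of P are t *: (X *m v) and t *: v with v a basis vector outside *)
(* the kernel of X; the scalar t normalizes the determinant.                   *)
Lemma nilpotent_conj X : \tr X = 0 -> \det X = 0 -> X != 0 ->
  exists2 P, \det P = 1 & X *m P = P *m e.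
Proof.
rewrite [X]mx2_eta; move: (X 0 0) (X 0 1) (X 1 0) (X 1 1) => a b c d.
rewrite tr_mx2 det_mx2 => /eqP; rewrite addrC addr_eq0 => /eqP-> det0.
have bc : b * c = - a ^+ 2 by rewrite -[LHS]addr0 -det0; ring.
(* The vector v is the first basis vector when b = 0, since then a = 0 and c is nonzero, and the
   second one otherwise. *)
move=> X0; have [b0|b0] := eqVneq b 0.
  have a0 : a = 0.
    by move/eqP: bc; rewrite b0 mul0r eq_sym oppr_eq0 expf_eq0 => /eqP.
  have c0 : c != 0.
    apply: contraNneq X0 => c0; apply/eqP.
    by rewrite a0 b0 c0 oppr0 mx2_0.
  have [t t2] := sqrtC_exists (- c^-1); exists (mx2 0 t (t * c) 0).
    rewrite det_mx2; transitivity (- c * t ^+ 2); first by ring.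
    by rewrite t2; field.
  by rewrite a0 b0 !mx2M; congr mx2; ring.
have [t t2] := sqrtC_exists b^-1; exists (mx2 (t * b) 0 (- t * a) t).
  rewrite det_mx2; transitivity (b * t ^+ 2); first by ring.
  by rewrite t2; field.
rewrite !mx2M; congr mx2; try by ring.
transitivity (t * (b * c + a ^+ 2)); first by ring.
by rewrite bc; ring.
Qed.

(** The eigenvalues a and -a are distinct. The columns of the conjugating matrix are eigenvectors,
    scaled to give determinant 1. *)
Lemma diagonalizable_conj X a : \tr X = 0 -> \det X = - a ^+ 2 -> a != 0 ->
  exists b, exists2 P, \det P = 1 & X *m P = P *m (b *: h).
Proof.
rewrite [X]mx2_eta; move: (X 0 0) (X 0 1) (X 1 0) (X 1 1) => p q r s.
rewrite tr_mx2 det_mx2 => /eqP; rewrite addrC addr_eq0 => /eqP-> detE a0.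
have qr : q * r = a ^+ 2 - p ^+ 2 by rewrite -[a ^+ 2]opprK -detE; ring.
have two0 : 2%:R != 0 :> C by rewrite pnatr_eq0.
have [q0|q0] := eqVneq q 0; last first.
  have -> : r = (a ^+ 2 - p ^+ 2) / q by rewrite -qr mulrAC divff ?mul1r.
  (* The eigenvectors are (q, a - p) for a and (q, -a - p) for -a, the latter divided by -2aq. *)
  exists a, (mx2 q (- (2%:R * a)^-1) (a - p) ((a + p) / (2%:R * a * q))).
    by rewrite det_mx2; field; rewrite a0 q0.
  by rewrite !mx2E; congr mx2; field; rewrite ?a0 ?q0.
have p0 : p != 0.
  apply: contraNneq a0 => p0; move/eqP: qr.
  by rewrite q0 p0 mul0r expr0n /= subr0 eq_sym sqrf_eq0.
(* Here X is lower triangular with eigenvalues p and -p, and p^2 = a^2. *)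
exists p, (mx2 (2%:R * p) 0 r (2%:R * p)^-1); first by rewrite det_mx2; field.
by rewrite q0 !mx2E; congr mx2; field.
Qed.

(** A nonzero determinant gives two distinct eigenvalues; otherwise X is nilpotent, and X = 0 falls
    under the first alternative with b = 0. *)
Lemma sl2_conj X : \tr X = 0 ->
  (exists b, exists2 P, \det P = 1 & X *m P = P *m (b *: h)) \/
  (exists2 P, \det P = 1 & X *m P = P *m e).
Proof.
move=> tX; have [a] := sqrtC_exists (- \det X).
move/(congr1 -%R); rewrite opprK => /esym detX.
have [a0|a0] := eqVneq a 0; last by left; apply: diagonalizable_conj detX a0.
have [->|X0] := eqVneq X 0.
  by left; exists 0, 1%:M; rewrite ?det1 // mul0mx scale0r mulmx0.
by right; apply: nilpotent_conj; rewrite // detX a0 expr0n oppr0.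
Qed.

(** First X is brought to e. The relation then forces Y to become -h/2 + q e, and a unipotent matrix
    commuting with e removes the term q e. *)
Lemma K2_pair_conj X Y : \tr Y = 0 -> X != 0 -> X *m Y - Y *m X = X ->
  exists2 P, \det P = 1 & X *m P = P *m e /\ (-2%:R *: Y) *m P = P *m h.
Proof.
move=> tY X0 XY.
have two0 : 2%:R != 0 :> C by rewrite pnatr_eq0.
have tX : \tr X = 0 by rewrite -XY raddfB /= [\tr (Y *m X)]mxtrace_mulC subrr.
have detX : \det X = 0.
  move: tX tY XY; rewrite [X]mx2_eta [Y]mx2_eta.
  move: (X 0 0) (X 0 1) (X 1 0) (X 1 1) => a b c d.
  move: (Y 0 0) (Y 0 1) (Y 1 0) (Y 1 1) => p q r s.
  rewrite !tr_mx2 => /eqP; rewrite addrC addr_eq0 => /eqP->.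
  move=> /eqP; rewrite addrC addr_eq0 => /eqP->.
  rewrite !mx2E => /mx2_inj[ea eb ec _].
  have: 2%:R * (a * - a - b * c) = 0.
    (* This is minus the trace of X [X, Y], which vanishes identically; replacing [X, Y] by X turns
       it into 2 det X. *)
    transitivity (- 2%:R * a * (a * p + b * r - (p * a + q * c))
      - c * (a * q + b * - p - (p * b + q * - a))
      - b * (c * p + - a * r - (r * a + - p * c))); last by ring.
    by rewrite ea eb ec; ring.
  by move/eqP; rewrite mulf_eq0 (negPf two0) => /eqP.
have [P dP XP] := nilpotent_conj tX detX X0.
have uP : P \in unitmx by rewrite unitmxE dP unitr1.
have [Z YP tZ] : exists2 Z, Y *m P = P *m Z & \tr Z = 0.
  exists (invmx P *m (Y *m P)); first by rewrite mulKVmx.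
  by rewrite mxtrace_mulC mulmxK.
have eZ : e *m Z - Z *m e = e.
  apply: (can_inj (mulKmx uP)); rewrite mulmxBr !mulmxA -XP -YP -!mulmxA -YP -XP.
  by rewrite !mulmxA -mulmxBl XY.
move: tZ eZ YP; rewrite [Z]mx2_eta; move: (Z 0 0) (Z 0 1) (Z 1 0) (Z 1 1) => p q r s.
rewrite tr_mx2 => /eqP; rewrite addrC addr_eq0 => /eqP->.
rewrite /sl2_e !mx2E => /mx2_inj[r0 p0 _ _] YP.
(* The factor [mx2 1 q 0 1] centralizes e and conjugates h - 2q e to h. *)
exists (P *m mx2 1 q 0 1); first by rewrite det_mulmx dP mul1r det_mx2; ring.
rewrite !mulmxA -!scalemxAl XP YP -!mulmxA scalemxAr.
split; first by rewrite !mx2E; congr (_ *m mx2 _ _ _ _); ring.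
have rE : r = 0 by rewrite -r0; ring.
have pE : p = - 2%:R^-1.
  apply: (mulfI two0); transitivity (- (0 * q + 1 * - p - (p * 1 + q * 0))).
    by ring.
  by rewrite p0; field.
by rewrite rE pE !mx2E; congr (_ *m mx2 _ _ _ _); field.
Qed.

(** The generators are the images of z1 and z2, the latter rescaled by -2 so that its normal form is
    h rather than -h/2. *)
Lemma K2_subalgebra_gens S : {subset S <= so4 (F := C)} -> isomorphic_to_K2 S ->
  exists X1 X2 Y1 Y2 : 'M[C]_2,
    [/\ S = <<[:: diag2 X1 X2; diag2 (-2%:R *: Y1) (-2%:R *: Y2)]>>%VS,
        \tr Y1 = 0 /\ \tr Y2 = 0, (X1 != 0) || (X2 != 0),
        X1 *m Y1 - Y1 *m X1 = X1 & X2 *m Y2 - Y2 *m X2 = X2].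
Proof.
move=> S_so4 [f [kf Sf fK]].
have mem_f u : f u \in S by rewrite -Sf memv_img ?memvf.
have [X1 [X2 [_ _ fz1]]] := so4P _ (S_so4 _ (mem_f (z1 C))).
have [Y1 [Y2 [tY1 tY2 fz2]]] := so4P _ (S_so4 _ (mem_f (z2 C))).
have := fK (z1 C) (z2 C); rewrite K2_bracket_z fz1 fz2 -/(diag2 _ _) -/(diag2 Y1 _).
rewrite /bracket !diag2E => /diag2_inj[XY1 XY2].
exists X1, X2, Y1, Y2; split=> //.
- rewrite -Sf -diag2Z /diag2 -fz1 -fz2; apply/vspaceP=> v.
  apply/memv_imgP/mem_span2 => [[u _ ->]|[c [d ->]]].
    exists (u 0 0), (- u 0 1 / 2%:R); rewrite scalerA {1}(K2_basis u) linearD !linearZ /=.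
    by congr (_ + _ *: _); field.
  exists (c *: z1 C + (d * -2%:R) *: z2 C); first exact: memvf.
  by rewrite linearD !linearZ /= scalerA mulrC.
(* If both blocks vanished, z1 would lie in the kernel of the injective map [f]. *)
- rewrite -negb_and; apply/negP=> /andP[/eqP X10 /eqP X20].
  have : z1 C \in lker f by rewrite memv_ker fz1 X10 X20 block_mx0.
  by rewrite kf memv0 => /eqP/matrixP/(_ 0 0)/eqP; rewrite !mxE /= oner_eq0.
Qed.

Lemma K2_subalgebra_classification S :
    {subset S <= so4 (F := C)} -> isomorphic_to_K2 S ->
  exists i : K2_index C, equivalent S (K2_sub i).
Proof.
move=> S_so4 /(K2_subalgebra_gens S_so4)[X1 [X2 [Y1 [Y2 [-> [tY1 tY2] X0 XY1 XY2]]]]].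
have conj U V U' V' P Q A B A' B' : \det P = 1 -> \det Q = 1 ->
    U *m P = P *m A -> U' *m P = P *m A' -> V *m Q = Q *m B -> V' *m Q = Q *m B' ->
  equivalent <<[:: diag2 U V; diag2 U' V']>>%VS <<[:: diag2 A B; diag2 A' B']>>%VS.
  move=> dP dQ eU eU' eV eV'; apply: (@equivalent_span2 _ (diag2 P Q)).
  - by exists P, Q.
  - by rewrite !diag2M eU eV.
  - by rewrite !diag2M eU' eV'.
have t2 Y : \tr Y = 0 -> \tr (-2%:R *: Y) = 0 by move=> tY; rewrite mxtraceZ tY mulr0.
have c0 P : 0 *m P = P *m 0 by rewrite mul0mx mulmx0.
(* A zero first block leaves families 4 and 5, separated by the normal form of -2 Y1. *)
have [X10|X10] := eqVneq X1 0.
  move: X0; rewrite X10 eqxx => /= X20.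
  have [Q dQ [eX eY]] := K2_pair_conj tY2 X20 XY2.
  case: (sl2_conj (t2 _ tY1)) => [[a [P dP eP]]|[P dP eP]].
    by exists (I4 a); rewrite K2_sub_diag2; apply: (conj _ _ _ _ P Q).
  by exists I5; rewrite K2_sub_diag2; apply: (conj _ _ _ _ P Q).
have [P dP [eX eY]] := K2_pair_conj tY1 X10 XY1.
(* A zero second block leaves families 2 and 3; two nonzero blocks give family 1. *)
have [X20|X20] := eqVneq X2 0.
  rewrite X20; case: (sl2_conj (t2 _ tY2)) => [[a [Q dQ eQ]]|[Q dQ eQ]].
    by exists (I2 a); rewrite K2_sub_diag2; apply: (conj _ _ _ _ P Q).
  by exists I3; rewrite K2_sub_diag2; apply: (conj _ _ _ _ P Q).
have [Q dQ [eX' eY']] := K2_pair_conj tY2 X20 XY2.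
by exists I1; rewrite K2_sub_diag2; apply: (conj _ _ _ _ P Q).
Qed.

End Classification.

Theorem theorem5p3 (R : realType) :
  (forall i : K2_index R[i],
      subalgebra (K2_sub i) /\ isomorphic_to_K2 (K2_sub i)) /\
  (forall S : {vspace 'M[R[i]]_(2 + 2)},
      subalgebra S -> isomorphic_to_K2 S ->
      exists i : K2_index R[i], equivalent S (K2_sub i)) /\
  (forall i j : K2_index R[i],
      K2_family i <> K2_family j -> ~ equivalent (K2_sub i) (K2_sub j)) /\
  (forall a b : R[i],
      equivalent (K2_sub (I2 a)) (K2_sub (I2 b)) <-> a = b \/ a = - b) /\
  (forall a b : R[i],
      equivalent (K2_sub (I4 a)) (K2_sub (I4 b)) <-> a = b \/ a = - b).
Proof.
split; first by move=> i; apply: K2_sub_subalgebra_iso; rewrite pnatr_eq0.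
split; first by move=> S [S_so4 _]; apply: K2_subalgebra_classification.
split=> [i j /eqP|].
  rewrite neq_ltn => /orP[lt_ij|lt_ji]; first exact: K2_sub_inequivalent.
  by move/equivalent_sym; apply: K2_sub_inequivalent.
split; [exact: K2_sub_I2_equivalent | exact: K2_sub_I4_equivalent].
Qed.
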